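(* The discrete multirate Lagrangian flow $F^{\Delta T}_{L_d}\colon Q\times Q\to Q\times Q$, $(q_{k-1},q_k)\mapsto(q_k,q_{k+1})$, is symplectic, i.e. it preserves the discrete symplectic form $\Omega_{L_d}$: $(F^{\Delta T}_{L_d})^*\Omega_{L_d}=\Omega_{L_d}$.
   Context: Let $Q=Q^s\times Q^f$ be an open subset of $\mathbb{R}^{n}$, $n=n^s+n^f$, with slow variables $q^s\in Q^s$ and fast variables $q^f\in Q^f$. Let $\Delta T=p\,\Delta t$ with $p\in\mathbb{N}$. The slow variable is discretized on macro nodes $t_k=k\Delta T$ ($k=0,\dots,N$) by $q_k^s$, and the fast variable on micro nodes $t_k^m=k\Delta T+m\Delta t$ ($k=0,\dots,N-1$, $m=0,\dots,p$) by $q_k^{f,m}$, where $q_{k-1}^{f,p}=q_k^{f,0}$. Write $q_k^f=(q_k^{f,0},\dots,q_k^{f,p})$ and $q_k=(q_k^s,q_k^{f,0})$ (so $q_{k+1}=(q_{k+1}^s,q_k^{f,p})$). A multirate discrete Lagrangian is a smooth real function $L_d(q_k^s,q_{k+1}^s,q_k^f)$. $D_{*}$ denotes the partial derivative with respect to the argument $*$. Stationarity of the discrete action $\sum_{k=0}^{N-1}L_d(q_k^s,q_{k+1}^s,q_k^f)$ with respect to variations with fixed $q_0^s,q_N^s,q_0^{f,0},q_{N-1}^{f,p}$ gives the discrete multirate Euler-Lagrange equations: $$D_{q_k^s}\big(L_d(q_k^s,q_{k+1}^s,q_k^f)+L_d(q_{k-1}^s,q_k^s,q_{k-1}^f)\big)=0,\quad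 k=1,\dots,N-1,$$ $$D_{q_k^{f,0}}\big(L_d(q_k^s,q_{k+1}^s,q_k^f)+L_d(q_{k-1}^s,q_k^s,q_{k-1}^f)\big)=0,\quad k=1,\dots,N-1,$$ $$D_{q_k^{f,m}}L_d(q_k^s,q_{k+1}^s,q_k^f)=0,\quad k=0,\dots,N-1,\ m=1,\dots,p-1.$$ The inner micro values $q_k^{f,1},\dots,q_k^{f,p-1}$ are assumed to be determined by $(q_k,q_{k+1})$ through the third set of equations; evaluating $L_d$ on these values gives the two-point discrete Lagrangian $L_d(q_k,q_{k+1})=\operatorname{ext}_{(q_k^{f,1},\dots,q_k^{f,p-1})}L_d(q_k^s,q_{k+1}^s,q_k^f)$ on $Q\times Q$. The discrete multirate Lagrangian flow $F^{\Delta T}_{L_d}(q_{k-1},q_k)=(q_k,q_{k+1})$ is the map defined by solving the discrete multirate Euler-Lagrange equations (assumed to define such a map). The discrete Lagrangian one-forms on $Q\times Q$ are $$\Theta_{L_d}^-(q_k,q_{k+1})=-D_{q_k^s}L_d(q_k^s,q_{k+1}^s,q_k^f)\,dq_k^s-D_{q_k^{f,0}}L_d(q_k^s,q_{k+1}^s,q_k^f)\,dq_k^{f,0},$$ $$\Theta_{L_d}^+(q_k,q_{k+1})=D_{q_{k+1}^s}L_d(q_k^s,q_{k+1}^s,q_k^f)\,dq_{k+1}^s+D_{q_k^{f,p}}L_d(q_k^s,q_{k+1}^s,q_k^f)\,dq_k^{f,p},$$ with the inner micro values eliminated as described, and the discrete symplectic form is $\Omega_{L_d}=d\Theta_{L_d}^-=d\Theta_{L_d}^+$.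 *)

(* Defs.v *)
From mathcomp Require Import all_boot all_order all_algebra.
From mathcomp Require Import boolp classical_sets functions reals topology.
From mathcomp Require Import normedtype derive.

Set Implicit Arguments.
Unset Strict Implicit.
Unset Printing Implicit Defensive.

Import Order.TTheory GRing.Theory Num.Theory.
Import numFieldNormedType.Exports.

Local Open Scope classical_set_scope.
Local Open Scope ring_scope.

Section Calculus.
Context {R : realType}.

(* All spaces used below are finite-dimensional, where continuity of all
   iterated directional derivatives (along constant vectors) is the usual
   class C^n.  The set [A] is meant to be open. *)
Fixpoint Cn_on {V W : normedModType R} (A : set V) (n : nat) (f : V -> W)
    : Prop :=
  match n with
  | 0%N => forall x, A x -> {for x, continuous f}
  | n'.+1 => (forall x, A x -> differentiable f x) /\
             (forall v, Cn_on A n' (fun x => 'D_v f x))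
  end.

Definition smooth_on {V W : normedModType R} (A : set V) (f : V -> W) : Prop :=
  forall n, Cn_on A n f.

(* On a vector space [V], a one-form maps a base point and a tangent vector to
   a scalar, a two-form maps a base point and two tangent vectors to a scalar *)
Definition one_form (V : normedModType R) : Type := V -> V -> R.
Definition two_form (V : normedModType R) : Type := V -> V -> V -> R.

(* d theta (u, v) = u(theta(v)) - v(theta(u)) - theta([u, v]); the bracket
   vanishes because [u] and [v] are extended to constant vector fields *)
Definition ext_deriv {V : normedModType R} (theta : one_form V) : two_form V :=
  fun z u v => 'D_u (fun x => theta x v) z - 'D_v (fun x => theta x u) z.

Definition pullback {V W : normedModType R} (F : V -> W) (omega : two_form W)
    : two_form V :=
  fun z u v => omega (F z) ('d F z u) ('d F z v).

End Calculus.

Section Multirate.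
Context {R : realType} {ns nf p : nat}.

Local Notation slow := 'rV[R]_ns.
Local Notation fast := 'rV[R]_nf.
(* (q^{f,0}, ..., q^{f,p}), the m-th row being q^{f,m} *)
Local Notation micro := 'M[R]_(p.+1, nf).
Local Notation config := ('rV[R]_ns * 'rV[R]_nf)%type.
Local Notation lagrangian := ('rV[R]_ns * 'rV[R]_ns * 'M[R]_(p.+1, nf) -> R).

Definition micro_in (Qf : set fast) : set micro :=
  [set A | forall m : 'I_p.+1, Qf (row m A)].

Definition set_row (A : micro) (m : 'I_p.+1) (y : fast) : micro :=
  \matrix_(i, j) (if i == m then y 0 j else A i j).

(* Partial derivatives of L(x, x', A), as covectors: D_x, D_{x'} and D_{A_m} *)
Definition D_slow0 (L : lagrangian) (x x' : slow) (A : micro) : slow -> R :=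
  'd (fun y : slow => L (y, x', A)) x.
Definition D_slow1 (L : lagrangian) (x x' : slow) (A : micro) : slow -> R :=
  'd (fun y : slow => L (x, y, A)) x'.
Definition D_fast (L : lagrangian) (m : 'I_p.+1) (x x' : slow) (A : micro)
    : fast -> R :=
  'd (fun y : fast => L (x, x', set_row A m y)) (row m A).

Definition inner_EL (L : lagrangian) (x x' : slow) (A : micro) : Prop :=
  forall m : 'I_p.+1, (0 < m < p)%N -> forall v, D_fast L m x x' A v = 0.

(* Discrete curves in Q with N macro steps; only [qs k] for k <= N and [qf k]
   for k < N are relevant *)
Definition multirate_curve (Qs : set slow) (Qf : set fast) (N : nat)
    (qs : nat -> slow) (qf : nat -> micro) : Prop :=
  [/\ forall k, (k <= N)%N -> Qs (qs k),
      forall k, (k < N)%N -> micro_in Qf (qf k) &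
      forall k, (0 < k < N)%N -> row ord_max (qf k.-1) = row ord0 (qf k)].

Definition multirate_EL (L : lagrangian) (N : nat)
    (qs : nat -> slow) (qf : nat -> micro) : Prop :=
  [/\ forall k, (0 < k < N)%N -> forall v : slow,
        'd (fun x : slow => L (x, qs k.+1, qf k) + L (qs k.-1, x, qf k.-1))
          (qs k) v = 0,
      forall k, (0 < k < N)%N -> forall v : fast,
        'd (fun y : fast => L (qs k, qs k.+1, set_row (qf k) ord0 y) +
                            L (qs k.-1, qs k, set_row (qf k.-1) ord_max y))
          (row ord0 (qf k)) v = 0 &
      forall k, (k < N)%N -> inner_EL L (qs k) (qs k.+1) (qf k)].

Definition EL_triple (Qs : set slow) (Qf : set fast) (L : lagrangian)
    (q0 q1 q2 : config) : Prop :=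
  exists qs qf,
    [/\ multirate_curve Qs Qf 2 qs qf,
        multirate_EL L 2 qs qf,
        q0 = (qs 0%N, row ord0 (qf 0%N)),
        q1 = (qs 1%N, row ord0 (qf 1%N)) &
        q2 = (qs 2%N, row ord_max (qf 1%N))].

(* [F] maps Q x Q to itself by (q0, q1) |-> (q1, q2), where q2 is the unique
   point of Q solving the discrete equations with q0 and q1; the values of [F]
   outside Q x Q are irrelevant *)
Definition is_multirate_flow (Qs : set slow) (Qf : set fast) (L : lagrangian)
    (F : config * config -> config * config) : Prop :=
  forall q0 q1, (Qs `*` Qf) q0 -> (Qs `*` Qf) q1 ->
    exists q2, [/\ (Qs `*` Qf) q2, F (q0, q1) = (q1, q2) &
      forall q, (Qs `*` Qf) q -> (EL_triple Qs Qf L q0 q1 q <-> q = q2)].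

Definition micro_between (Qf : set fast) (q q' : config) : set micro :=
  [set A | [/\ micro_in Qf A, row ord0 A = q.2 & row ord_max A = q'.2]].

(* [phi (q, q')] is the full micro path from q to q', whose inner values are
   the ones determined by the equations at the inner micro nodes *)
Definition determines_inner (Qs : set slow) (Qf : set fast) (L : lagrangian)
    (phi : config * config -> micro) : Prop :=
  forall q q', (Qs `*` Qf) q -> (Qs `*` Qf) q' ->
    micro_between Qf q q' (phi (q, q')) /\
    forall A, micro_between Qf q q' A ->
      (inner_EL L q.1 q'.1 A <-> A = phi (q, q')).

(* The tangent vector [v] is (dq_k, dq_{k+1}), with dq_k = (dq_k^s, dq_k^{f,0})
   and dq_{k+1} = (dq_{k+1}^s, dq_k^{f,p}) *)
Definition Theta_minus (L : lagrangian) (phi : config * config -> micro)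
    : one_form (config * config)%type :=
  fun z v => - D_slow0 L z.1.1 z.2.1 (phi z) v.1.1
             - D_fast L ord0 z.1.1 z.2.1 (phi z) v.1.2.

Definition Theta_plus (L : lagrangian) (phi : config * config -> micro)
    : one_form (config * config)%type :=
  fun z v => D_slow1 L z.1.1 z.2.1 (phi z) v.2.1
             + D_fast L ord_max z.1.1 z.2.1 (phi z) v.2.2.

Definition Omega (L : lagrangian) (phi : config * config -> micro)
    : two_form (config * config)%type :=
  ext_deriv (Theta_minus L phi).

End Multirate.

(* Main.v *)
(* On the open set Q x Q the two-point Lagrangian S satisfies
   dS = Theta^+ - Theta^-, since the inner Euler-Lagrange equations annihilate
   the contributions of the inner micro values; symmetry of the second
   derivatives of S then gives d Theta^- = d Theta^+.  The Euler-Lagrange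
   equations at the middle node say that F^* Theta^- = Theta^+, and therefore
   F^* Omega = d (F^* Theta^-) = d Theta^+ = Omega. *)

Require Import Defs.
From mathcomp Require Import all_boot all_order all_algebra.
From mathcomp Require Import boolp classical_sets functions reals topology.
From mathcomp Require Import normedtype landau derive.
From mathcomp Require Import ring lra.

Import Order.TTheory GRing.Theory Num.Theory.
Import numFieldNormedType.Exports.

Local Open Scope classical_set_scope.
Local Open Scope ring_scope.

(** * Symmetry of second directional derivatives *)

Section SecondDerivatives.
Context {R : realType} {V : normedModType R}.
Implicit Types (f : V -> R) (z w u v : V).

Lemma is_derive_line {f w u} {s : R} :
  derivable f (s *: u + w) u ->
  is_derive s 1 (fun t => f (t *: u + w)) ('D_u f (s *: u + w)).
Proof.
have E : (fun h : R => h^-1 *: (f ((h *: 1 + s) *: u + w) - f (s *: u + w))) =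
         (fun h : R => h^-1 *: (f (h *: u + (s *: u + w)) - f (s *: u + w))).
  by apply/funext => h; rewrite scalerDl addrA [h *: 1]mulr1.
by move=> fd; apply: DeriveDef; rewrite /derivable /derive E.
Qed.

Lemma diff_remainder {f z} {e : R} : differentiable f z -> 0 < e ->
  exists2 d, 0 < d & forall x, `|x| < d ->
    `|f (x + z) - f z - 'd f z x| <= e * `|x|.
Proof.
move=> fd e0; have /eqaddoP /(_ e e0) /nbhs_norm0P [d d0 H] := diff_locally fd.
by exists d => // x /H; rewrite !fctE opprD addrA.
Qed.

(* The mean value theorem along u writes the second difference as
   h (D_u f (z + xi u + h v) - D_u f (z + xi u)), which is then expanded by the
   differentiability of D_u f at z. *)
Lemma second_difference {f z u v} {e : R} :
  (\forall x \near z, differentiable f x) ->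
  differentiable ('D_u f) z -> 0 < e ->
  exists2 d, 0 < d & forall h : R, 0 < h < d ->
    `|f (h *: u + (h *: v + z)) - f (h *: u + z) - f (h *: v + z) + f z
      - h ^+ 2 * 'D_v ('D_u f) z| <= e * h ^+ 2.
Proof.
move=> /nbhs_normP [d1 /= d10 fd] gd e0.
(* The summand 1 keeps [M] positive even if [u] and [v] vanish. Every [s *: u + t *: v] with [s] and
   [t] between 0 and [h] has norm at most [h * M]. *)
set M := `|u| + `|v| + 1.
have M0 : 0 < M by rewrite ltr_wpDl ?addr_ge0.
(* Two remainders, each at most [e / (2 * M) * (h * M) = e * h / 2], will add up to [e * h]; the
   mean value theorem supplies the other factor [h]. *)
have e'0 : 0 < e / (2 * M) by rewrite divr_gt0 // mulr_gt0.
have [d2 d20 gr] := diff_remainder gd e'0.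
pose d := Num.min d1 d2.
have d0 : 0 < d by rewrite lt_min d10.
exists (d / M) => [|h /andP[h0]]; first by rewrite divr_gt0.
rewrite ltr_pdivlMr // => hd.
have near_z s t : 0 <= s <= h -> 0 <= t <= h -> `|s *: u + t *: v| <= h * M.
  move=> /andP[s0 sh] /andP[t0 th].
  rewrite (le_trans (ler_normD _ _)) // !normrZ !ger0_norm // /M.
  by have := normr_ge0 u; have := normr_ge0 v; nra.
have h0h : 0 <= h <= h by rewrite lexx ltW.
have z0h : 0 <= (0 : R) <= h by rewrite lexx ltW.
have fl s t : 0 <= s <= h -> 0 <= t <= h ->
    is_derive s 1 (fun r => f (r *: u + (t *: v + z)))
      ('D_u f (s *: u + (t *: v + z))).
  move=> sh th; apply: is_derive_line; apply: diff_derivable; apply: fd => /=.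
  rewrite -normrN opprB addrA addrK (le_lt_trans (near_z _ _ sh th)) //.
  by rewrite (lt_le_trans hd) // ge_min lexx.
(* The second difference is [k h - k 0]. The term [0 *: v] is kept so that [fl] and [near_z] apply
   to both edges, with [t = h] and [t = 0]. *)
pose k (s : R) := f (s *: u + (h *: v + z)) - f (s *: u + (0 *: v + z)).
pose dk (s : R) := 'D_u f (s *: u + (h *: v + z)) - 'D_u f (s *: u + (0 *: v + z)).
have kd s : 0 <= s <= h -> is_derive s 1 k (dk s).
  by move=> sh; have := fl _ _ sh h0h; have := fl _ _ sh z0h => *; apply: is_deriveB.
have [||xi] := @MVT R k dk 0 h h0.
- by move=> s; rewrite in_itv /= => /andP[s0 sh]; apply: kd; rewrite !ltW.
- apply: derivable_within_continuous => s; rewrite in_itv /= => sh.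
  by have [] := kd s sh.
rewrite in_itv /= => /andP[xi0 xih]; rewrite subr0 => kE.
have xh : 0 <= xi <= h by rewrite !ltW.
have /gr r1 : `|xi *: u + h *: v| < d2.
  by rewrite (le_lt_trans (near_z _ _ xh h0h)) // (lt_le_trans hd) // ge_min lexx orbT.
have /gr r2 : `|xi *: u + 0 *: v| < d2.
  by rewrite (le_lt_trans (near_z _ _ xh z0h)) // (lt_le_trans hd) // ge_min lexx orbT.
have -> : f (h *: u + (h *: v + z)) - f (h *: u + z) - f (h *: v + z) + f z
    = dk xi * h.
  by rewrite -kE /k !scale0r !add0r; lra.
have eM : e / (2 * M) * (h * M) = e * h / 2.
  by field; rewrite gt_eqF.
have {}r1 := le_trans r1 (ler_wpM2l (ltW e'0) (near_z _ _ xh h0h)).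
have {}r2 := le_trans r2 (ler_wpM2l (ltW e'0) (near_z _ _ xh z0h)).
rewrite eM in r1 r2.
rewrite (deriveE _ gd) /dk.
move: r1 r2; rewrite !linearD !linearZ /= -!addrA.
set a := 'D_u f (_ + (h *: v + _)); set b := 'D_u f (_ + (0 *: v + _)).
set c := 'D_u f z; set A := 'd _ z u; set B := 'd _ z v.
rewrite /GRing.scale /= => /ler_normlP [r1 r1'] /ler_normlP [r2 r2'].
have -> : (a - b) * h + h ^+ 2 * - B = (a - b - h * B) * h by ring.
have -> : e * h ^+ 2 = e * h * h by ring.
rewrite normrM [`|h|]gtr0_norm // ler_wpM2r ?(ltW h0) //.
by apply/ler_normlP; split; lra.
Qed.

(** The second difference is symmetric in [u] and [v], so the two mixed derivatives, multiplied by
    [h ^+ 2], approximate the same number. Each error is at most [e / 2 * h ^+ 2], and dividing by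
    [h ^+ 2] leaves a gap of at most [e]. *)
Lemma derive_sym f z u v :
  (\forall x \near z, differentiable f x) ->
  differentiable ('D_u f) z -> differentiable ('D_v f) z ->
  'D_u ('D_v f) z = 'D_v ('D_u f) z.
Proof.
move=> fd du dv; apply/eqP; rewrite -subr_eq0 -normr_eq0; apply/eqP.
apply/le_anti; rewrite normr_ge0 andbT; apply/ler_addgt0Pl => e e0.
rewrite addr0.
have e20 : 0 < e / 2 by rewrite divr_gt0.
have [d d0 H] := @second_difference f z u v _ fd du e20.
have [d' d'0 H'] := @second_difference f z v u _ fd dv e20.
pose h := Num.min d d' / 2.
have m0 : 0 < Num.min d d' by rewrite lt_min d0.
have h0 : 0 < h by rewrite divr_gt0.
have hm : h < Num.min d d' by rewrite /h; lra.
have {hm} [hd hd'] : h < d /\ h < d' by move: hm; rewrite lt_min => /andP.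
have {}H := H h ltac:(by rewrite h0).
have {}H' := H' h ltac:(by rewrite h0).
move: H H'; rewrite [h *: u + (h *: v + z)]addrCA.
have h20 : 0 < h ^+ 2 by rewrite exprn_gt0.
move=> /ler_normlP [r1 r1'] /ler_normlP [r2 r2'].
rewrite -(ler_pM2l h20) -[X in X * _](gtr0_norm h20) -normrM.
move: r1 r1' r2 r2'; move: ('D_u _ z) ('D_v _ z) (f _) (f _) (f _) (f _) (h ^+ 2).
by move=> a b c1 c2 c3 c4 k *; apply/ler_normlP; split; lra.
Qed.

End SecondDerivatives.

(** * Differentials along lines and under local equality *)

Section DirectionalDerivatives.
Context {R : realType} {V W : normedModType R}.

Lemma is_derive_affine {f : V -> W} {z v w} :
  (forall h : R, f (h *: v + z) = h *: w + f z) -> is_derive z v f w.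
Proof.
move=> fE.
suff H : h^-1 *: (f (h *: v + z) - f z) @[h --> (0 : R)^'] --> w.
  by apply: DeriveDef; [apply/cvg_ex; exists w|exact: cvg_lim].
apply: cvg_near_cst; near=> h; rewrite fE addrK scalerA mulVf ?scale1r //.
by near: h; exact: nbhs_dnbhs_neq.
Unshelve. all: by end_near. Qed.

(** The difference quotients of the composite along [a] are literally those of [f] along [w]. This
    turns a partial derivative of [L] into its total differential on a vector with one nonzero
    component. *)
Lemma diff_comp_affine {f : W -> R} {g : V -> W} {y a w} :
  differentiable f (g y) -> differentiable g y ->
  (forall h : R, g (h *: a + y) = h *: w + g y) ->
  'd (fun x => f (g x)) y a = 'd f (g y) w.
Proof.
move=> fd gd gE.
rewrite -(deriveE _ (differentiable_comp gd fd)) -(deriveE _ fd) /derive /=.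
by under eq_fun do rewrite gE.
Qed.

Lemma near_eq_differentiable {f g : V -> W} {z} :
  (\forall x \near z, f x = g x) -> differentiable f z -> differentiable g z.
Proof.
move=> fg fd; have [fc] := (diff_locallyP _ _).1 fd.
move=> /eqaddoP fo.
(* The first-order expansion of [f] also holds for [g], because the two maps agree near [z] and at
   [z]; [diff_unique] then identifies the differentials. *)
have go : g \o shift z = cst (g z) + 'd f z +o_ (0 : V) id.
  apply/eqaddoP => e e0; have fg0 : \forall x \near (0 : V), f (x + z) = g (x + z).
    by have := fg; rewrite (near_shift 0) /= subr0.
  near=> x; have : `|(f \o shift z - (cst (f z) + 'd f z)) x| <= e * `|id x|.
    by near: x; exact: fo.
  rewrite !fctE /=; have -> : f (x + z) = g (x + z) by near: x.
  by rewrite (nbhs_singleton fg).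
by apply/diff_locallyP; rewrite (diff_unique fc go).
Unshelve. all: by end_near. Qed.

Lemma diffD_fun {f g : V -> W} {z v} :
  differentiable f z -> differentiable g z ->
  'd (fun x => f x + g x) z v = 'd f z v + 'd g z v.
Proof. by move=> fd gd; rewrite (diffD fd gd). Qed.

Lemma diff_linear_comp {U : normedModType R} {g : V -> W}
    {l : {linear W -> U}} {z} v :
  continuous l -> differentiable g z ->
  'd (fun x => l (g x)) z v = l ('d g z v).
Proof.
move=> lc gd; have ld := @linear_differentiable _ _ _ l (g z) lc.
by rewrite (diff_comp gd ld) /= diff_lin.
Qed.

End DirectionalDerivatives.

(** * Micro paths as matrices and their rows *)

Section MicroRows.
Context {R : realType} {nf p : nat}.
Implicit Types (A B : 'M[R]_(p.+1, nf)) (m : 'I_p.+1) (y : 'rV[R]_nf).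

Lemma set_rowD A m y (a : 'rV[R]_nf) (h : R) :
  set_row A m (h *: a + y) = h *: set_row 0 m a + set_row A m y.
Proof.
by apply/matrixP => i j; rewrite !mxE; case: eqP; rewrite ?mxE ?mulr0 ?add0r.
Qed.

Lemma set_row_id A m : set_row A m (row m A) = A.
Proof. by apply/matrixP => i j; rewrite !mxE; case: eqP => [->|]. Qed.

Lemma sum_set_row B : \sum_m set_row 0 m (row m B) = B.
Proof.
apply/matrixP => i j; rewrite summxE (bigD1 i) //= big1 ?addr0 => [|k ki].
  by rewrite !mxE eqxx.
by rewrite !mxE eq_sym (negPf ki).
Qed.

Lemma differentiable_set_row A m y : differentiable (set_row A m) y.
Proof.
(* The map is affine: a constant matrix with row [m] cleared, plus the coordinates of [y] times
   elementary matrices. *)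
have -> : set_row A m = cst (set_row A m 0) +
    \sum_(j < nf) (fun y : 'rV[R]_nf => y 0 j *: delta_mx m j).
  apply/funext => x; apply/matrixP => i j; rewrite !fctE fct_sumE /= !mxE.
  rewrite summxE; case: eqP => [->|/eqP im].
    rewrite (bigD1 j) //= big1 => [|k kj]; rewrite !mxE !eqxx ?mulr1 ?add0r ?addr0 //.
    by rewrite eq_sym (negPf kj) andbF mulr0.
  by rewrite big1 ?addr0 // => k _; rewrite !mxE (negPf im) mulr0.
apply: differentiableD; first exact: differentiable_cst.
apply: differentiable_sum => j; apply: differentiableZl.
exact: differentiable_coord.
Qed.

(** Meant for the end rows of [phi], which are pinned to the fast coordinates of the two endpoints;
    their derivatives are then read off entry by entry. *)
Lemma row_derive {V : normedModType R} {f : V -> 'M[R]_(p.+1, nf)}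
    {g : V -> 'rV[R]_nf} {m z v w} :
  differentiable f z -> (\forall x \near z, row m (f x) = g x) ->
  (forall h : R, g (h *: v + z) = h *: w + g z) ->
  row m ('d f z v) = w.
Proof.
move=> fd fg gE; have fv : derivable f z v := diff_derivable fd.
rewrite -(deriveE _ fd) derive_mx //; apply/rowP => j; rewrite !mxE.
have /near_eq_derive -> : \forall x \near z, f x m j = g x 0 j.
  by near=> x; have /rowP /(_ j) : row m (f x) = g x; [near: x|rewrite mxE].
have [|_ ->] := @is_derive_affine _ _ _ (fun x => g x 0 j : R) z v (w 0 j) => //.
by move=> h; rewrite gE !mxE.
Unshelve. all: by end_near. Qed.

End MicroRows.

(** * Partial derivatives of the discrete Lagrangian *)

Section PartialDerivatives.
Context {R : realType} {ns nf p : nat}.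
Local Notation slow := 'rV[R]_ns.
Local Notation micro := 'M[R]_(p.+1, nf).
Variables (L : slow * slow * micro -> R) (x x' : slow) (A : micro).
Hypothesis Ld : differentiable L (x, x', A).

Lemma differentiable_slow0 : differentiable (fun y => L (y, x', A)) x.
Proof.
by apply: (@differentiable_comp _ _ _ _ (fun y => (y, x', A)) L).
Qed.

Lemma differentiable_slow1 : differentiable (fun y => L (x, y, A)) x'.
Proof.
apply: (@differentiable_comp _ _ _ _ (fun y => (x, y, A)) L) => //.
by apply: differentiable_pair => //; apply: differentiable_pair.
Qed.

Lemma differentiable_fast m :
  differentiable (fun y => L (x, x', set_row A m y)) (row m A).
Proof.
apply: (@differentiable_comp _ _ _ _ (fun y => (x, x', set_row A m y)) L).
  by apply: differentiable_pair => //; exact: differentiable_set_row.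
by rewrite set_row_id.
Qed.

Lemma D_slow0E a : D_slow0 L x x' A a = 'd L (x, x', A) (a, 0, 0).
Proof.
rewrite /D_slow0 (@diff_comp_affine _ _ _ L (fun y => (y, x', A)) x a (a, 0, 0)) //.
by move=> h; congr (_, _, _) => /=; rewrite scaler0 add0r.
Qed.

Lemma D_slow1E a : D_slow1 L x x' A a = 'd L (x, x', A) (0, a, 0).
Proof.
rewrite /D_slow1 (@diff_comp_affine _ _ _ L (fun y => (x, y, A)) x' a (0, a, 0)) //.
  by apply: differentiable_pair => //; apply: differentiable_pair.
by move=> h; congr (_, _, _) => /=; rewrite scaler0 add0r.
Qed.

Lemma D_fastE m a :
  D_fast L m x x' A a = 'd L (x, x', A) (0, 0, set_row 0 m a).
Proof.
rewrite /D_fast (@diff_comp_affine _ _ _ L (fun y => (x, x', set_row A m y))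
  (row m A) a (0, 0, set_row 0 m a)) ?set_row_id //.
  by apply: differentiable_pair => //; exact: differentiable_set_row.
by move=> h; congr (_, _, _) => /=; rewrite ?scaler0 ?add0r // set_rowD set_row_id.
Qed.

(** By linearity of the total differential: [B] is the sum of the matrices that carry one of its
    rows each, and each partial derivative is the total differential on one summand. *)
Lemma diff_partials a b (B : micro) :
  'd L (x, x', A) (a, b, B) =
  D_slow0 L x x' A a + D_slow1 L x x' A b + \sum_m D_fast L m x x' A (row m B).
Proof.
rewrite D_slow0E D_slow1E (eq_bigr _ (fun m _ => D_fastE m (row m B))).
rewrite -linear_sum -!linearD; congr ('d _ _ _).
have -> : \sum_m ((0, 0, set_row 0 m (row m B)) : slow * slow * micro) = (0, 0, B).
  rewrite -[in RHS](sum_set_row B).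
  apply: (big_rec2 (fun u C => u = (0, 0, C))) => // m u C _ ->.
  by congr (_, _, _); rewrite addr0.
by congr (_, _, _); rewrite /= ?addr0 ?add0r.
Qed.

End PartialDerivatives.

Lemma near_setX {T U : topologicalType} {A : set T} {B : set U} {z : T * U} :
  (\forall x \near z.1, A x) -> (\forall x \near z.2, B x) ->
  \forall x \near z, (A `*` B) x.
Proof. by move=> a b; exists (A, B). Qed.

(** * The two-point Lagrangian and differentiability of the one-forms *)

Section Flow.
Context {R : realType} {ns nf p : nat}.
Local Notation slow := 'rV[R]_ns.
Local Notation fast := 'rV[R]_nf.
Local Notation micro := 'M[R]_(p.+1, nf).
Local Notation config := (slow * fast)%type.
Variables (Qs : set slow) (Qf : set fast).
Variables (L : slow * slow * micro -> R) (phi : config * config -> micro).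
Variable F : config * config -> config * config.
Hypotheses (hp : (0 < p)%N) (oQs : open Qs) (oQf : open Qf).
Hypothesis smL : smooth_on ((Qs `*` Qs) `*` micro_in Qf) L.
Hypothesis phiP : determines_inner Qs Qf L phi.
Hypothesis smphi : smooth_on ((Qs `*` Qf) `*` (Qs `*` Qf)) phi.
Hypothesis FP : is_multirate_flow Qs Qf L F.
Hypothesis smF : smooth_on ((Qs `*` Qf) `*` (Qs `*` Qf)) F.

Local Notation QQ := ((Qs `*` Qf) `*` (Qs `*` Qf)).
(** [G] fills in the extremal inner micro values, so [S] below is the two-point discrete Lagrangian
    on Q x Q. *)
Let G (z : config * config) : slow * slow * micro := (z.1.1, z.2.1, phi z).
Let S (z : config * config) : R := L (G z).

Lemma near_QQ {z} : QQ z -> \forall x \near z, QQ x.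
Proof.
move=> [[z11 z12] [z21 z22]].
by apply: near_setX; apply: near_setX; apply: open_nbhs_nbhs.
Qed.

Let differentiable_ends z :
  differentiable (fun x : config * config => (x.1.1, x.2.1)) z.
Proof.
have fst_diff (V W : normedModType R) (x : V * W) : differentiable fst x.
  by apply: linear_differentiable => y; exact: cvg_fst.
have snd_diff (V W : normedModType R) (x : V * W) : differentiable snd x.
  by apply: linear_differentiable => y; exact: cvg_snd.
by apply: differentiable_pair; apply: differentiable_comp.
Qed.

Let G_diff z : QQ z -> differentiable G z.
Proof.
by move=> Uz; apply: differentiable_pair => //; exact: (smphi 1%N).1.
Qed.

Let phi_between z : QQ z -> micro_between Qf z.1 z.2 (phi z).
Proof. by case: z => q q' [qQ q'Q]; case: (phiP _ _ qQ q'Q). Qed.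

Let phi_inner z : QQ z -> inner_EL L z.1.1 z.2.1 (phi z).
Proof.
case: z => q q' Uz; have phib := phi_between _ Uz; case: Uz => qQ q'Q.
by have [_ /(_ _ phib) ->] := phiP _ _ qQ q'Q.
Qed.

Let G_in z : QQ z -> ((Qs `*` Qs) `*` micro_in Qf) (G z).
Proof. by move=> Uz; have [phiQ _ _] := phi_between _ Uz; case: Uz => [[? ?] []]. Qed.

Let L_diff z : QQ z -> differentiable L (G z).
Proof. by move=> /G_in Uz; exact: (smL 1%N).1. Qed.

Let DL_diff w z : QQ z -> differentiable (fun x => 'd L (G x) w) z.
Proof.
move=> Uz.
(* Smoothness is phrased with ['D_w L], while the one-forms use ['d L]; the two agree only where [L]
   is differentiable, hence the passage through a neighbourhood in Q x Q. *)
apply: (@near_eq_differentiable _ _ _ (fun x => 'D_w L (G x))).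
  by near=> x; rewrite deriveE //; apply: L_diff; near: x; exact: near_QQ.
apply: (@differentiable_comp _ _ _ _ G ('D_w L)); first exact: G_diff.
by have [_ /(_ w) []] := smL 2%N => H _; apply: H; exact: G_in.
Unshelve. all: by end_near. Qed.

Let Theta_minus_diff w z : QQ z -> differentiable (Theta_minus L phi ^~ w) z.
Proof.
move=> Uz.
apply: (@near_eq_differentiable _ _ _ (- (fun x => 'd L (G x) (w.1.1, 0, 0))
    - (fun x => 'd L (G x) (0, 0, set_row 0 ord0 w.1.2)))).
  near=> x; have Ld : differentiable L (G x) by apply: L_diff; near: x; exact: near_QQ.
  by rewrite !fctE /Theta_minus D_slow0E // D_fastE.
by apply: differentiableB; [apply: differentiableN|]; exact: DL_diff.
Unshelve. all: by end_near. Qed.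

Let Theta_plus_diff w z : QQ z -> differentiable (Theta_plus L phi ^~ w) z.
Proof.
move=> Uz.
apply: (@near_eq_differentiable _ _ _ ((fun x => 'd L (G x) (0, w.2.1, 0))
    + (fun x => 'd L (G x) (0, 0, set_row 0 ord_max w.2.2)))).
  near=> x; have Ld : differentiable L (G x) by apply: L_diff; near: x; exact: near_QQ.
  by rewrite !fctE /Theta_plus D_slow1E // D_fastE.
by apply: differentiableD; exact: DL_diff.
Unshelve. all: by end_near. Qed.

(** * The differential of the two-point Lagrangian and the symplectic form *)

Let phi_row0 z v : QQ z -> row ord0 ('d phi z v) = v.1.2.
Proof.
move=> Uz; apply: (@row_derive _ _ _ _ _ (fun x => x.1.2)) => //.
  exact: (smphi 1%N).1.
near=> x; have /phi_between[] // : QQ x by near: x; exact: near_QQ.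
Unshelve. all: by end_near. Qed.

Let phi_row_max z v : QQ z -> row ord_max ('d phi z v) = v.2.2.
Proof.
move=> Uz; apply: (@row_derive _ _ _ _ _ (fun x => x.2.2)) => //.
  exact: (smphi 1%N).1.
near=> x; have /phi_between[] // : QQ x by near: x; exact: near_QQ.
Unshelve. all: by end_near. Qed.

Let diff_G z v : QQ z -> 'd G z v = (v.1.1, v.2.1, 'd phi z v).
Proof.
move=> Uz; have Gd := G_diff _ Uz.
have E1 : ('d G z v).1 = (v.1.1, v.2.1).
  rewrite -(@diff_linear_comp _ _ _ _ G fst) //; last by move=> y; exact: cvg_fst.
  rewrite -deriveE //.
  by have [] := @is_derive_affine _ _ _
    (fun x : config * config => (x.1.1, x.2.1)) z v (v.1.1, v.2.1).
have E2 : ('d G z v).2 = 'd phi z v.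
  by rewrite -(@diff_linear_comp _ _ _ _ G snd) //; move=> y; exact: cvg_snd.
by rewrite [LHS]surjective_pairing E1 E2.
Qed.

Let derive_S z v : QQ z ->
  'D_v S z = Theta_plus L phi z v - Theta_minus L phi z v.
Proof.
move=> Uz; have Ld := L_diff _ Uz; have Gd := G_diff _ Uz.
rewrite deriveE; last exact: differentiable_comp.
rewrite /S (diff_comp Gd Ld) /= diff_G // diff_partials //.
(* Since [0 < p], the first and last rows are distinct and both split off the sum. Every remaining
   index satisfies [0 < m < p], so the inner equations kill its term. *)
rewrite (bigD1 ord0) //= (bigD1 ord_max) /=; last by rewrite -val_eqE /= -lt0n.
rewrite big1 => [|m /andP[m0 mp]].
  by rewrite phi_row0 // phi_row_max // /Theta_plus /Theta_minus; lra.
apply: phi_inner => //; rewrite lt0n ltn_neqAle -ltnS ltn_ord andbT.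
by rewrite -!(inj_eq val_inj) in m0 mp; rewrite m0 mp.
Qed.

Let Theta_jump z u v : QQ z ->
  'D_u (Theta_plus L phi ^~ v) z - 'D_u (Theta_minus L phi ^~ v) z =
  'D_u ('D_v S) z.
Proof.
move=> Uz; rewrite -deriveB; try by apply: diff_derivable; auto.
apply: near_eq_derive; near=> x; rewrite derive_S //.
by near: x; exact: near_QQ.
Unshelve. all: by end_near. Qed.

Lemma ext_deriv_ThetaE z u v : QQ z ->
  Omega L phi z u v = ext_deriv (Theta_plus L phi) z u v.
Proof.
(* Second-order regularity of [S] comes from the identity [derive_S] and the differentiability of
   the one-forms, rather than from differentiating [phi] twice. *)
move=> Uz; have DS_diff w : differentiable ('D_w S) z.
  apply: (@near_eq_differentiable _ _ _
    (Theta_plus L phi ^~ w - Theta_minus L phi ^~ w)).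
    near=> x; rewrite derive_S //; near: x; exact: near_QQ.
  by apply: differentiableB; auto.
have : 'D_u ('D_v S) z = 'D_v ('D_u S) z.
  apply: derive_sym => //; near=> x; have Ux : QQ x by near: x; exact: near_QQ.
  by apply: differentiable_comp; auto.
have sub_swap (a b c d : R) : a - b = c - d -> b - d = a - c by move=> *; lra.
move=> E; apply: sub_swap.
exact: etrans (etrans (Theta_jump z u v Uz) E) (esym (Theta_jump z v u Uz)).
Unshelve. all: by end_near. Qed.

(** * Euler-Lagrange equations at the middle node and invariance under the flow *)

Let EL_Theta q0 q1 q2 v w : (Qs `*` Qf) q0 -> (Qs `*` Qf) q1 -> (Qs `*` Qf) q2 ->
  EL_triple Qs Qf L q0 q1 q2 -> w.1 = v.2 ->
  Theta_minus L phi (q1, q2) w = Theta_plus L phi (q0, q1) v.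
Proof.
move=> q0Q q1Q q2Q [qs [qf [[_ fQ fE] [ELs ELf ELi] q0E q1E q2E]]] wv.
have U01 : QQ (q0, q1) by [].
have U12 : QQ (q1, q2) by [].
(* Uniqueness of the inner values identifies both micro paths of the curve with values of [phi]. The
   gluing condition [fE] matches the last row of [qf 0] with the fast part of [q1]. *)
have phi0 : phi (q0, q1) = qf 0%N.
  have [_ H] := phiP _ _ q0Q q1Q; apply/esym/H.
    by split; rewrite ?q0E ?q1E //=; [exact: fQ|exact: (fE 1%N)].
  by rewrite q0E q1E; exact: ELi.
have phi1 : phi (q1, q2) = qf 1%N.
  have [_ H] := phiP _ _ q1Q q2Q; apply/esym/H.
    by split; rewrite ?q1E ?q2E //=; exact: fQ.
  by rewrite q1E q2E; exact: ELi.
have Ld0 : differentiable L (qs 0%N, qs 1%N, qf 0%N).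
  by have := L_diff _ U01; rewrite /G phi0 q0E q1E.
have Ld1 : differentiable L (qs 1%N, qs 2%N, qf 1%N).
  by have := L_diff _ U12; rewrite /G phi1 q1E q2E.
(* Here [a + b] is the fast equation and [c + d] the slow one; [a] and [c] come from the step
   leaving [q1], [b] and [d] from the step arriving there. *)
have EL_balance (a b c d : R) : a + b = 0 -> c + d = 0 -> - c - a = d + b.
  by move=> *; lra.
have rE := fE 1%N isT; rewrite /= in rE.
have := ELs 1%N isT v.2.1; have := ELf 1%N isT v.2.2.
rewrite /= (diffD_fun (differentiable_slow0 _ _ _ _ Ld1) (differentiable_slow1 _ _ _ _ Ld0)).
have := differentiable_fast _ _ _ _ Ld0 ord_max; rewrite rE => Ldm.
rewrite (diffD_fun (differentiable_fast _ _ _ _ Ld1 ord0) Ldm).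
rewrite /Theta_minus /Theta_plus phi0 phi1 wv q0E q1E q2E /= /D_slow0 /D_slow1 /D_fast rE.
exact: EL_balance.
Qed.

(* (F z).1 = z.2, so the first component of dF_z v is the constant v.2 and
   x |-> Theta_minus (F x) (dF_z v) coincides with x |-> Theta_plus x v: no
   second derivative of F is needed. *)
Lemma pullback_OmegaE z u v : QQ z ->
  pullback F (Omega L phi) z u v = ext_deriv (Theta_plus L phi) z u v.
Proof.
have flow x : QQ x -> [/\ QQ (F x), (F x).1 = x.2 &
    forall v w, w.1 = v.2 -> Theta_minus L phi (F x) w = Theta_plus L phi x v].
  case: x => q0 q1 [q0Q q1Q]; have [q2 [q2Q -> qE]] := FP _ _ q0Q q1Q.
  split=> // v' w; apply: EL_Theta => //; exact/(qE _ q2Q).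
move=> Uz; have Fd : differentiable F z by exact: (smF 1%N).1.
have F1 w : ('d F z w).1 = w.2.
  rewrite -(@diff_linear_comp _ _ _ _ F fst) //; last by move=> y; exact: cvg_fst.
  rewrite -deriveE; last first.
    by apply: differentiable_comp => //; apply: linear_differentiable => y; exact: cvg_fst.
  have /near_eq_derive -> : \forall x \near z, (F x).1 = x.2.
    by near=> x; have /flow[] : QQ x by near: x; exact: near_QQ.
  by have [] := @is_derive_affine _ _ _ snd z w w.2.
(* Chain rule through [F] with the vector ['d F z v'] frozen at [z]. By [F1] its first component is
   [v'.2], so [flow] applies at every [x] near [z] with this same vector. *)
have key u' v' : 'D_('d F z u') (Theta_minus L phi ^~ ('d F z v')) (F z) =
    'D_u' (Theta_plus L phi ^~ v') z.
  have [UF _ _] := flow _ Uz.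
  have Td := Theta_minus_diff ('d F z v') _ UF.
  rewrite (deriveE _ Td) -[LHS]/(('d _ (F z) \o 'd F z) u') -(diff_comp Fd Td).
  rewrite -deriveE; last exact: differentiable_comp.
  apply: near_eq_derive; near=> x.
  have /flow[_ _ /(_ v' ('d F z v'))] : QQ x by near: x; exact: near_QQ.
  exact.
by rewrite /pullback /Omega /ext_deriv !key.
Unshelve. all: by end_near. Qed.

End Flow.

Theorem theorem3p1 (R : realType) (ns nf p : nat) (hp : (0 < p)%N)
    (Qs : set 'rV[R]_ns) (Qf : set 'rV[R]_nf)
    (oQs : open Qs) (oQf : open Qf)
    (L : 'rV[R]_ns * 'rV[R]_ns * 'M[R]_(p.+1, nf) -> R)
    (smL : smooth_on ((Qs `*` Qs) `*` micro_in Qf) L)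
    (phi : ('rV[R]_ns * 'rV[R]_nf) * ('rV[R]_ns * 'rV[R]_nf) ->
           'M[R]_(p.+1, nf))
    (phiP : determines_inner Qs Qf L phi)
    (smphi : smooth_on ((Qs `*` Qf) `*` (Qs `*` Qf)) phi)
    (F : ('rV[R]_ns * 'rV[R]_nf) * ('rV[R]_ns * 'rV[R]_nf) ->
         ('rV[R]_ns * 'rV[R]_nf) * ('rV[R]_ns * 'rV[R]_nf))
    (FP : is_multirate_flow Qs Qf L F)
    (smF : smooth_on ((Qs `*` Qf) `*` (Qs `*` Qf)) F) :
  (forall z u v, ((Qs `*` Qf) `*` (Qs `*` Qf)) z ->
     Omega L phi z u v = ext_deriv (Theta_plus L phi) z u v) /\
  (forall z u v, ((Qs `*` Qf) `*` (Qs `*` Qf)) z ->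
     pullback F (Omega L phi) z u v = Omega L phi z u v).
Proof.
have symF := @ext_deriv_ThetaE _ _ _ _ Qs Qf L phi hp oQs oQf smL phiP smphi.
split=> [|z u v Uz]; first exact: symF.
by rewrite (@pullback_OmegaE _ _ _ _ Qs Qf L phi F oQs oQf smL phiP smphi FP smF) // symF.
Qed.
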